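(* Let $(X,\mathcal{B},\mu,T)$ be an invertible probability measure preserving system. For any measurable set $A$ satisfying $\mu(A)\in(0,1)$, there exist infinitely many $N\in\mathbb{N}$ such that $$\frac{1}{N}\sum_{n=0}^{N-1}\mu(A\cap T^{n}A)>\mu(A)^2.$$
   Context: Here $N$ ranges over positive integers. *)

(* Defs.v *)
From HB Require Import structures.
From mathcomp Require Import all_boot all_order all_algebra.
From mathcomp Require Import all_classical all_reals all_analysis.

Set Implicit Arguments.
Unset Strict Implicit.
Unset Printing Implicit Defensive.

Import Order.TTheory GRing.Theory Num.Theory.
Import numFieldNormedType.Exports.

Local Open Scope classical_set_scope.

(* The probability measure is carried by its type [probability X R].
   The third field says that the inverse map of [T] is measurable: the image of
   a set under a bijection is its preimage under the inverse. *)
Record invertible_pmp (d : measure_display) (X : measurableType d)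
    (R : realType) (mu : probability X R) (T : X -> X) : Prop := InvertiblePmp {
  ipmp_bijective : bijective T ;
  ipmp_measurable : measurable_fun [set: X] T ;
  ipmp_measurable_inv : forall A : set X, measurable A -> measurable (T @` A) ;
  ipmp_preserving :
    forall A : set X, measurable A -> mu (T @^-1` A) = mu A
}.

(* Main.v *)
Require Import Defs.
From HB Require Import structures.
From mathcomp Require Import all_boot all_order all_algebra.
From mathcomp Require Import all_classical all_reals all_analysis.
From mathcomp Require Import measurable_realfun.
From mathcomp Require Import lra.

Set Implicit Arguments.
Unset Strict Implicit.
Unset Printing Implicit Defensive.

Import Order.TTheory GRing.Theory Num.Theory.
Import numFieldNormedType.Exports.

Local Open Scope classical_set_scope.
Local Open Scope ring_scope.
Local Open Scope ereal_scope.

(** Write [c n] for the correlation [mu (A `&` T^n A) - mu A ^ 2] and [S N] for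
    the partial sum [c 0 + ... + c (N - 1)]; the inequality at [N] says exactly
    that [S N > 0].

    The sequence [c] is positive definite: as [T] preserves [mu], [c |i - j|] is
    the covariance of the indicators of [T^i A] and [T^j A], so that the sum of
    [c |i - j|] over [i, j < N] is the variance of the sum of those indicators,
    hence nonnegative ([sqr_sum_measure_le], [measure_iter_imageI]). On the other
    hand this double sum equals [2 (S 1 + ... + S N) - N c 0] ([sum_toeplitz]).
    Therefore [S 1 + ... + S N >= N c 0 / 2], and [c 0 = mu A (1 - mu A)] is
    positive, so these sums tend to infinity. Were [S N <= 0] for all large [N],
    they would be bounded above; hence [S N > 0] for arbitrarily large [N]
    ([partial_sum_gt0_infinitely_often]). *)

(** Passing from [N] to [N + 1] adds to the square of indices a corner, worth
    [c 0], and two borders, each worth [c 1 + ... + c N]; that is twice the next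
    partial sum of [c], minus [c 0]. The distance [|i - j|] is written
    [(i - j) + (j - i)] with truncated subtractions. *)
Lemma sum_toeplitz (V : zmodType) (c : nat -> V) (N : nat) :
  (\sum_(0 <= i < N) \sum_(0 <= j < N) c ((i - j) + (j - i))%N =
   (\sum_(0 <= k < N) \sum_(0 <= n < k.+1) c n) *+ 2 - c 0%N *+ N)%R.
Proof.
elim: N => [|N IHN]; first by rewrite !big_nil mul0rn mulr0n subr0.
have border f : (forall j, (j < N)%N -> f j = c (N - j)%N) ->
    (\sum_(0 <= j < N) f j = \sum_(0 <= n < N.+1) c n - c 0%N)%R.
  move=> fc; rewrite big_nat_recl// addrC addKr big_nat_rev /=.
  apply: eq_big_nat => j /andP[_ jN].
  by rewrite fc add0n ?subKn// ltn_subrL/= (leq_trans _ jN).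
rewrite big_nat_recr//= (eq_bigr _ (fun i _ => big_nat_recr _ _ _ (leq0n N))) /=.
rewrite big_split/= IHN (border (fun i => c ((i - N) + (N - i))%N)); last first.
  by move=> j jN; rewrite (eqP (ltnW jN)).
rewrite [X in (_ + X)%R]big_nat_recr//=.
rewrite (border (fun i => c ((N - i) + (i - N))%N)); last first.
  by move=> j jN; rewrite (eqP (ltnW jN)) addn0.
rewrite subnn addn0 [in RHS]big_nat_recr//= mulrnDl (mulrSr _ N) opprD.
set S := (\sum_(0 <= n < N.+1) c n)%R.
rewrite subrK -!addrA; do 2!congr (_ + _)%R.
by rewrite addrCA; congr (_ + _)%R; rewrite addrA addrC.
Qed.

(** By [sum_toeplitz] the hypothesis bounds the sum of the first [N] partial sums
    of [c] below by [N * c 0 / 2], which is unbounded; this is impossible if the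
    partial sums are eventually nonpositive. *)
Lemma partial_sum_gt0_infinitely_often (R : archiRealFieldType) (c : nat -> R) :
  (0 < c 0%N)%R ->
  (forall N, 0 <= \sum_(0 <= i < N) \sum_(0 <= j < N) c ((i - j) + (j - i))%N)%R ->
  forall M, exists2 N, (M <= N)%N & (0 < \sum_(0 <= n < N) c n)%R.
Proof.
move=> c0 cpd M; apply: contrapT => no.
pose S N := (\sum_(0 <= n < N) c n)%R.
have S_le0 N : (M <= N)%N -> (S N <= 0)%R.
  by move=> MN; rewrite leNgt; apply/negP => SN; apply: no; exists N.
pose C := (\sum_(0 <= k < M) S k.+1)%R.
have bounded N : (M <= N)%N -> (\sum_(0 <= k < N) S k.+1 <= C)%R.
  move=> MN; rewrite (big_cat_nat (leq0n M) MN)/= gerDl.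
  rewrite big_nat_cond; apply: sumr_le0 => k; rewrite andbT => /andP[Mk _].
  by apply: S_le0; exact: leqW.
have [K CK] : exists K : nat, (C *+ 2 / c 0%N < K%:R)%R.
  exists (Num.bound `|C *+ 2 / c 0%N|%R).
  by apply: le_lt_trans (ler_norm _) (archi_boundP (normr_ge0 _)).
move: CK; rewrite ltr_pdivrMr// mulr_natl => CK.
have := cpd (maxn M K); rewrite sum_toeplitz subr_ge0.
apply/negP; rewrite -ltNge.
have /le_lt_trans : ((\sum_(0 <= k < maxn M K) S k.+1) *+ 2 <= C *+ 2)%R.
  by rewrite lerMn2r bounded ?leq_maxl.
apply; apply: (lt_le_trans CK).
by rewrite ler_wpMn2l ?leq_maxr// ltW.
Qed.

(** Nonnegativity of the variance of [g], the sum of the indicators of the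
    [E i]: with [m] the mean of [g], integrate [2 m g <= g ^ 2 + m ^ 2]. Both
    sides of this form of [0 <= (g - m) ^ 2] are nonnegative, so they can be
    integrated term by term in the extended reals. *)
Lemma sqr_sum_measure_le (d : measure_display) (X : measurableType d)
    (R : realType) (mu : probability X R) (E : nat -> set X) (N : nat) :
  (forall i, measurable (E i)) ->
  (\sum_(0 <= i < N) mu (E i)) ^+ 2 <=
  \sum_(0 <= i < N) \sum_(0 <= j < N) mu (E i `&` E j).
Proof.
move=> mE.
pose m := (\sum_(0 <= i < N) fine (mu (E i)))%R.
have sumE : \sum_(0 <= i < N) mu (E i) = m%:E.
  by rewrite -sumEFin; apply: eq_bigr => i _; rewrite fineK// fin_num_measure.
have m0 : (0 <= m)%R by apply: sumr_ge0 => i _; apply: fine_ge0.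
have mI (B : set X) : measurable B -> measurable_fun setT (EFin \o (\1_B : X -> R)).
  by move=> mB; apply/measurable_EFinP; exact: measurable_indic.
pose g x : \bar R := \sum_(0 <= i < N) (\1_(E i) x : R)%:E.
have g0 x : 0 <= g x by apply: sume_ge0.
have mg : measurable_fun setT g by apply: emeasurable_sum => i; exact: mI.
have intg : \int[mu]_x g x = m%:E.
  rewrite /g ge0_integral_sum// => [|i]; last exact: mI.
  by rewrite -sumE; apply: eq_bigr => i _; rewrite integral_indic// setIT.
(* [h] is the square of [g], expanded as a sum of indicators *)
pose h x : \bar R := \sum_(0 <= i < N) \sum_(0 <= j < N) (\1_(E i `&` E j) x : R)%:E.
have mh : measurable_fun setT h.
  by do 2!apply: emeasurable_sum => ?; apply: mI; exact: measurableI.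
have h0 x : 0 <= h x by do 2!apply: sume_ge0 => ? _.
have inth : \int[mu]_x h x = \sum_(0 <= i < N) \sum_(0 <= j < N) mu (E i `&` E j).
  rewrite /h ge0_integral_sum//.
  - apply: eq_bigr => i _; rewrite ge0_integral_sum// => [|j]; last first.
      by apply: mI; exact: measurableI.
    by apply: eq_bigr => j _; rewrite integral_indic ?setIT//; exact: measurableI.
  - by move=> i; apply: emeasurable_sum => j; apply: mI; exact: measurableI.
  - by move=> i x _; apply: sume_ge0.
have AMGM x : (2 * m)%:E * g x <= h x + (m ^+ 2)%:E.
  pose r := (\sum_(0 <= i < N) \1_(E i) x : R)%R.
  have -> : g x = r%:E by rewrite /g sumEFin.
  have -> : h x = (r ^+ 2)%:E.
    rewrite /h expr2 /r mulr_suml -sumEFin; apply: eq_bigr => i _.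
    by rewrite mulr_sumr -sumEFin; apply: eq_bigr => j _; rewrite indicI.
  by rewrite -EFinM -EFinD lee_fin; have := sqr_ge0 (r - m)%R; lra.
have : \int[mu]_x ((2 * m)%:E * g x) <= \int[mu]_x (h x + (m ^+ 2)%:E).
  apply: ge0_le_integral => //.
  - by move=> x _; rewrite mule_ge0// lee_fin mulr_ge0.
  - by apply: measurable_funeM.
  - by apply: emeasurable_funD.
rewrite ge0_integralZl// ?lee_fin ?mulr_ge0// ge0_integralD//; last first.
  by move=> x _; rewrite lee_fin sqr_ge0.
rewrite integral_cst//= probability_setT mule1 intg inth sumE.
rewrite -!EFinM -leeBlDr//.
by rewrite -EFinB; apply: le_trans; rewrite lee_fin; lra.
Qed.

Lemma measure_iter_image (d : measure_display) (X : measurableType d)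
    (R : realType) (mu : probability X R) (T : X -> X) (n : nat) (A : set X) :
  invertible_pmp mu T -> measurable A ->
  measurable (iter n T @` A) /\ mu (iter n T @` A) = mu A.
Proof.
move=> hT mA; elim: n => [|n [mTA muTA]]; first by rewrite image_id.
have -> : iter n.+1 T @` A = T @` (iter n T @` A) by rewrite -image_comp.
split; first exact: (ipmp_measurable_inv hT).
rewrite -muTA -(ipmp_preserving hT); last exact: (ipmp_measurable_inv hT).
congr (mu _); apply/funext => x.
exact: image_inj (bij_inj (ipmp_bijective hT)).
Qed.

(** If [i <= j] then [T^i A] and [T^j A] meet in the image of [A `&` T^(j - i) A]
    under [T^i], by injectivity of [T], and [T^i] preserves the measure. *)
Lemma measure_iter_imageI (d : measure_display) (X : measurableType d)
    (R : realType) (mu : probability X R) (T : X -> X) (A : set X) (i j : nat) :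
  invertible_pmp mu T -> measurable A ->
  mu (iter i T @` A `&` iter j T @` A) =
  mu (A `&` iter ((i - j) + (j - i)) T @` A).
Proof.
move=> hT mA; wlog ij : i j / (i <= j)%N.
  move=> H; have [|/ltnW ji] := leqP i j; first exact: H.
  by rewrite setIC addnC; exact: H.
have -> : ((i - j) + (j - i) = j - i)%N by rewrite (eqP ij).
have injTi : injective (iter i T).
  by elim: (i) => [//|k IHk] x y /= /(bij_inj (ipmp_bijective hT)) /IHk.
have -> : iter j T @` A = iter i T @` (iter (j - i) T @` A).
  rewrite image_comp; congr (_ @` _); apply/funext => x /=.
  by rewrite -iterD subnKC.
have -> : iter i T @` A `&` iter i T @` (iter (j - i) T @` A) =
    iter i T @` (A `&` iter (j - i) T @` A).
  apply/seteqP; split; last exact: sub_image_setI.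
  by move=> _ [[x Ax <-]]; rewrite image_inj// => Bx; exists x.
apply: (measure_iter_image i hT _).2; apply: measurableI => //.
by have [] := measure_iter_image (j - i) hT mA.
Qed.

Theorem proposition1p9 (d : measure_display) (X : measurableType d)
    (R : realType) (mu : probability X R) (T : X -> X)
    (hT : invertible_pmp mu T)
    (A : set X) (mA : measurable A) (hA0 : 0 < mu A) (hA1 : mu A < 1) :
  infinite_set [set N : nat | (0 < N)%N /\
    mu A ^+ 2 <
      (N%:R^-1)%:E * \sum_(0 <= n < N) mu (A `&` (iter n T @` A))].
Proof.
have mTA n : measurable (iter n T @` A) by have [] := measure_iter_image n hT mA.
pose a := fine (mu A); have muA : mu A = a%:E by rewrite fineK// fin_num_measure.
pose m n := fine (mu (A `&` iter n T @` A)).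
have muI n : mu (A `&` iter n T @` A) = (m n)%:E.
  by rewrite fineK// fin_num_measure//; exact: measurableI.
pose c n := (m n - a ^+ 2)%R.
have sumc N : (\sum_(0 <= n < N) c n = \sum_(0 <= n < N) m n - a ^+ 2 *+ N)%R.
  by rewrite sumrB sumr_const_nat subn0.
have c0 : (0 < c 0%N)%R.
  move: hA0 hA1; rewrite muA !lte_fin => a0 a1.
  have m0 : m 0%N = a by rewrite /m image_id setIid.
  by rewrite /c m0 subr_gt0 expr2 gtr_pMl.
have cpd N : (0 <= \sum_(0 <= i < N) \sum_(0 <= j < N) c ((i - j) + (j - i))%N)%R.
  have := sqr_sum_measure_le mu N mTA.
  have -> : \sum_(0 <= i < N) mu (iter i T @` A) = \sum_(0 <= i < N) a%:E.
    by apply: eq_bigr => i _; rewrite (measure_iter_image i hT mA).2.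
  have -> : \sum_(0 <= i < N) \sum_(0 <= j < N)
      mu (iter i T @` A `&` iter j T @` A) =
      \sum_(0 <= i < N) (\sum_(0 <= j < N) m ((i - j) + (j - i))%N)%:E.
    apply: eq_bigr => i _; rewrite -sumEFin; apply: eq_bigr => j _.
    by rewrite measure_iter_imageI.
  rewrite !sumEFin -EFin_expe lee_fin -subr_ge0 => mpd.
  rewrite /c; under eq_bigr do rewrite sumrB sumr_const_nat subn0.
  by move: mpd; rewrite sumrB !sumr_const_nat subn0 exprMn_n -mulrnA.
(* A finite set of naturals is bounded; take [N] beyond its maximum. *)
move=> /finite_seqP[s sE].
have [N sN SN] := partial_sum_gt0_infinitely_often c0 cpd (\max_(i <- s) i).+1.
have N0 : (0 < N)%N by exact: leq_trans sN.
have Ns : [set` s] N.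
  rewrite -sE /=; split=> //; rewrite muA (eq_bigr _ (fun n _ => muI n)).
  rewrite sumEFin -!EFinM -expr2 lte_fin mulrC ltr_pdivlMr ?ltr0n//.
  by rewrite mulr_natr -subr_gt0 -sumc.
have := leq_bigmax_seq (P := xpredT) (F := id) N Ns isT.
by rewrite leqNgt sN.
Qed.
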